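(* Let $K=\{123,132\}\{213,312\}$ and let $f(n)$ be the number of equivalence classes of $S_n$ under $K$-equivalence. Then for all integers $n\ge 3$, $$f(n)=f(n-1)+(n-1)\cdot f(n-2).$$
   Context: Permutations in $S_n$ are written as words $\pi_1\pi_2\cdots\pi_n$ in one-line notation. The order permutation of a word $u$ of $c$ distinct positive integers is the unique $\sigma\in S_c$ with $\sigma_i<\sigma_j$ iff $u_i<u_j$. A replacement partition $K$ of $S_c$ is a set partition of $S_c$; it is denoted by listing its parts with the one-element parts (and outer brackets) omitted, so here $K$ is the set partition of $S_3$ whose only parts of size greater than one are $\{123,132\}$ and $\{213,312\}$. The $K$-equivalence on $S_n$ is the equivalence relation generated by: $\phi\equiv\psi$ whenever $\phi=aub$ and $\psi=avb$ (concatenations) for some possibly empty words $a,b$ and words $u,v$ of length $c$ (so $u,v$ occupy the same $c$ consecutive positions) such that the order permutations of $u$ and $v$ lie in the same part of $K$. All equivalence classes are counted, including one-element classes (so when $n<3$ every class is a singleton). *)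

(* Defs.v *)
From mathcomp Require Import all_boot all_fingroup.

Set Implicit Arguments.
Unset Strict Implicit.
Unset Printing Implicit Defensive.

(* One-line notation, with letters 1, ..., n (whereas 'I_n starts at 0). *)
Definition word n (s : 'S_n) : seq nat := [seq (s i).+1 | i <- enum 'I_n].

Definition is_order_perm c (u : seq nat) (s : 'S_c) : bool :=
  [&& size u == c, uniq u &
      [forall i : 'I_c, forall j : 'I_c,
        (s i < s j) == (nth 0 u i < nth 0 u j)]].

Definition same_part c (K : {set {set 'S_c}}) (u v : seq nat) : bool :=
  [exists P in K, exists s in P, exists t in P,
    is_order_perm u s && is_order_perm v t].

(* Boolean form of: phi = a u b and psi = a v b with |a| = k, |u| = |v| = c
   and u, v in the same part; see [kstepP]. *)
Definition kstep c (K : {set {set 'S_c}}) n : rel 'S_n := fun phi psi =>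
  [exists k : 'I_n.+1,
    [&& take k (word phi) == take k (word psi),
        drop (k + c) (word phi) == drop (k + c) (word psi) &
        same_part K (take c (drop k (word phi)))
                    (take c (drop k (word psi)))]].

(* [connect] is only the reflexive transitive closure, but [kstep] is
   symmetric, by [kstep_sym]. *)
Definition kequiv c (K : {set {set 'S_c}}) n : rel 'S_n :=
  connect (@kstep c K n).

Definition num_classes c (K : {set {set 'S_c}}) n : nat :=
  #|equivalence_partition (@kequiv c K n) [set: 'S_n]|.

(* The set partition of S_c whose parts of size greater than one are those
   listed in L (each given by its permutations in one-line notation). *)
Definition replacement_partition c (L : seq (seq (seq nat))) :
    {set {set 'S_c}} :=
  let parts := [set:: [seq [set s : 'S_c | word s \in p] | p <- L]] in
  parts :|: [set [set s] | s in ~: cover parts].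

Lemma size_word n (s : 'S_n) : size (word s) = n.
Proof. by rewrite size_map size_enum_ord. Qed.

Lemma nth_word n (s : 'S_n) (i : 'I_n) : nth 0 (word s) i = (s i).+1.
Proof. by rewrite (nth_map i) ?size_enum_ord // nth_ord_enum. Qed.

Lemma word_inj n : injective (@word n).
Proof.
move=> s t e; apply/permP => i; apply/val_inj/succn_inj.
by rewrite -!nth_word e.
Qed.

Lemma word_is_order_perm n (s : 'S_n) : is_order_perm (word s) s.
Proof.
apply/and3P; split; first by rewrite size_word.
- rewrite map_inj_uniq ?enum_uniq // => i j [] /val_inj; exact: perm_inj.
- by apply/forallP => i; apply/forallP => j; rewrite !nth_word ltnS.
Qed.

Lemma is_order_perm_inj c (u : seq nat) (s t : 'S_c) :
  is_order_perm u s -> is_order_perm u t -> s = t.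
Proof.
move=> /and3P[_ _ /forallP os] /and3P[_ _ /forallP ot].
have rank (r : 'S_c) i : val (r i) = #|[set j | r j < r i]|.
  have le := ltnW (ltn_ord (r i)).
  have winj : injective (widen_ord le).
    by move=> x y /(congr1 val) /= ?; apply: val_inj.
  rewrite -[LHS]card_ord -(card_imset _ winj) -(card_imset _ (@perm_inj _ r)).
  apply: eq_card => x; apply/imsetP/imsetP => -[y].
    by move=> _ ->; exists ((r^-1)%g (widen_ord le y)); rewrite ?inE permKV /=.
  by rewrite inE => lt ->; exists (Ordinal lt) => //; apply: val_inj.
apply/permP => i; apply: val_inj; rewrite (rank s) (rank t).
apply: eq_card => j; rewrite !inE.
by rewrite (eqP (forallP (os j) i)) (eqP (forallP (ot j) i)).
Qed.

Lemma same_part_sym c (K : {set {set 'S_c}}) u v :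
  same_part K u v = same_part K v u.
Proof.
apply/idP/idP => /exists_inP[P PK] /exists_inP[s sP] /exists_inP[t tP]
  /andP[us vt]; apply/exists_inP; exists P => //; apply/exists_inP; exists t;
  rewrite // ; apply/exists_inP; exists s; by rewrite // us vt.
Qed.

Lemma kstep_sym c (K : {set {set 'S_c}}) n : symmetric (@kstep c K n).
Proof.
move=> phi psi; apply: eq_existsb => k.
by rewrite same_part_sym (eq_sym (take _ _)) (eq_sym (drop _ _)).
Qed.

Lemma kequiv_equivalence c (K : {set {set 'S_c}}) n :
  equivalence_rel (@kequiv c K n).
Proof.
apply/equivalence_relP; split; first exact: connect0.
by move=> x y; apply/same_connect/sym_connect_sym/kstep_sym.
Qed.

Lemma kstepP c (K : {set {set 'S_c}}) n (phi psi : 'S_n) :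
  reflect (exists a u v b, [/\ word phi = a ++ u ++ b, word psi = a ++ v ++ b,
                               size u = c, size v = c & same_part K u v])
          (kstep K phi psi).
Proof.
apply: (iffP existsP) => [[k /and3P[/eqP ea /eqP eb uv]] |].
{ exists (take k (word phi)), (take c (drop k (word phi))),
    (take c (drop k (word psi))), (drop (k + c) (word phi)).
  have split3 w : take k w ++ take c (drop k w) ++ drop (k + c) w = w.
    by rewrite addnC -drop_drop !cat_take_drop.
  split; [by rewrite split3 | by rewrite ea eb split3 | | | by []].
  all: case/exists_inP: uv => P _ /exists_inP[s _] /exists_inP[t _].
  all: by case/andP=> /and3P[/eqP ? _ _] /and3P[/eqP ? _ _]. }
move=> [a [u [v [b [ephi epsi su sv uv]]]]].
have lt_a : size a < n.+1.
  by rewrite ltnS -(size_word phi) ephi size_cat leq_addr.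
exists (Ordinal lt_a); rewrite /= ephi epsi addnC -!drop_drop.
by rewrite !take_size_cat ?drop_size_cat ?take_size_cat ?eqxx ?drop_size_cat.
Qed.

(* Main.v *)
Require Import Defs.
From mathcomp Require Import all_boot all_fingroup.
From mathcomp Require Import zify.
From Stdlib Require Import Relations.

Set Implicit Arguments.
Unset Strict Implicit.
Unset Printing Implicit Defensive.

(** Orient the relation as a rewriting system on words with distinct letters:
    a factor p q r whose last letter r is the largest is rewritten, p q r with
    p < q < r into p r q, and p q r with q < p < r into r q p.  In both cases
    the smallest letter stays in place and the largest moves to the left, so
    the sum of position times letter decreases and rewriting terminates.  It is
    also locally confluent: disjoint rewrites commute, and for two overlapping
    factors, which span four or five letters, the two results are rewritten to
    a common word whatever the relative order of the letters
    ([head_ujoin], [local_confluence]).  By Newman's lemma each class of the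
    K-equivalence contains exactly one normal word, that is, exactly one word
    in which no letter is larger than the two letters just before it
    ([num_classesE]).

    Normal words are easily counted.  In a normal word the largest letter m is
    in position 1 or 2, since otherwise it exceeds the two letters before it.
    Conversely, if w is normal and all its letters are below m then m w is
    normal, and so is x m w for every letter x.  A normal word on n > 1 letters
    thus arises either from a normal word on n - 1 letters, or from a choice of
    x among n - 1 letters and a normal word on the n - 2 others
    ([num_normal_max]).  The number of normal words therefore satisfies the
    recurrence, which is that of the number of involutions. *)

(** * Newman's lemma *)

Section Newman.
Variables (A : Type) (R : relation A) (m : A -> nat).

(** Two elements are joinable when they have a common reduct. *)
Definition joinable s t :=
  exists2 u, clos_refl_trans A R s u & clos_refl_trans A R t u.

Lemma joinable_sym s t : joinable s t -> joinable t s.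
Proof. by case=> u su tu; exists u. Qed.

Hypothesis decr : forall s t, R s t -> m t < m s.
Hypothesis locally_confluent : forall s t u, R s t -> R s u -> joinable t u.

Lemma confluence s t u :
  clos_refl_trans A R s t -> clos_refl_trans A R s u -> joinable t u.
Proof.
have [k le_sk] := ubnP (m s); elim: k s t u le_sk => // k IH s t u le_sk.
move=> /clos_rt_rt1n_iff[|s1 {}t s_s1 s1_t].
  by move=> su; exists u => //; apply: rt_refl.
move=> /clos_rt_rt1n_iff[|s2 {}u s_s2 s2_u].
  exists t; first exact: rt_refl.
  by apply: rt_trans (rt_step _ _ _ _ s_s1) _; apply/clos_rt_rt1n_iff.
have lt1 : m s1 < k by apply: leq_trans (decr s_s1) _.
have lt2 : m s2 < k by apply: leq_trans (decr s_s2) _.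
have [v s1_v s2_v] := locally_confluent s_s1 s_s2.
move/clos_rt_rt1n_iff in s1_t; move/clos_rt_rt1n_iff in s2_u.
have [x t_x v_x] := IH _ _ _ lt1 s1_t s1_v.
have [y x_y u_y] := IH _ _ _ lt2 (rt_trans _ _ _ _ _ s2_v v_x) s2_u.
by exists y => //; apply: rt_trans t_x x_y.
Qed.

Lemma joinable_trans s t u : joinable s t -> joinable t u -> joinable s u.
Proof.
case=> x s_x t_x [y t_y u_y]; have [z x_z y_z] := confluence t_x t_y.
by exists z; [apply: rt_trans s_x x_z | apply: rt_trans u_y y_z].
Qed.

Lemma joinable_step s t : R s t -> joinable s t.
Proof. by move=> st; exists t; [apply: rt_step | apply: rt_refl]. Qed.

End Newman.

(** * The rewriting system *)

(** One rewriting step on an arbitrary word, in the direction that moves the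
    largest of the three letters to the left. *)
Inductive step : seq nat -> seq nat -> Prop :=
| step123 p q r w : p < q -> q < r -> step [:: p, q, r & w] [:: p, r, q & w]
| step213 p q r w : q < p -> p < r -> step [:: p, q, r & w] [:: r, q, p & w]
| step_cons x s t : step s t -> step (x :: s) (x :: t).

Lemma step_catl a s t : step s t -> step (a ++ s) (a ++ t).
Proof. by move=> st; elim: a => //= x a; apply: step_cons. Qed.

Lemma step_catr b s t : step s t -> step (s ++ b) (t ++ b).
Proof.
elim=> [p q r w|p q r w|x {}s {}t _] /=; first exact: step123.
  exact: step213.
exact: step_cons.
Qed.

Lemma stepP s t : step s t ->
  exists a p q r b, s = a ++ [:: p; q; r] ++ b /\
   (p < q < r /\ t = a ++ [:: p; r; q] ++ b
    \/ q < p < r /\ t = a ++ [:: r; q; p] ++ b).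
Proof.
elim=> [p q r w pq qr | p q r w qp pr | x {}s {}t _
  [a [p [q [r [b [-> H]]]]]]].
- by exists [::], p, q, r, w; split=> //; left; rewrite pq qr.
- by exists [::], p, q, r, w; split=> //; right; rewrite qp pr.
- exists (x :: a), p, q, r, b; split=> //.
  by case: H => -[cmp ->]; [left | right].
Qed.

Lemma step_perm s t : step s t -> perm_eq s t.
Proof.
elim=> [p q r w _ _|p q r w _ _|x {}s {}t _ st]; last by rewrite perm_cons.
all: by apply/seq.permP => P /=; lia.
Qed.

(** The sum of i times the letter in position i, positions starting at 0. *)
Fixpoint weight (s : seq nat) : nat :=
  if s is _ :: s' then sumn s' + weight s' else 0.

Lemma step_weight s t : step s t -> weight t < weight s.
Proof.
elim=> [p q r w|p q r w|x {}s {}t st]/=; try lia.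
have := perm_sumn (step_perm st); lia.
Qed.

(** Steps are restricted to words with distinct letters: with equal letters
    two one-step results may have no common reduct, as for the word 1 2 3 2 4,
    which reduces to the irreducible words 1 3 2 2 4 and 1 4 2 2 3. *)
Definition ustep s t := uniq s /\ step s t.

Definition reduces := clos_refl_trans (seq nat) ustep.

Lemma step_uniq s t : step s t -> uniq s -> uniq t.
Proof. by move=> /step_perm/perm_uniq->. Qed.

(** Joinability under the assumption of distinct letters, so that distinctness
    need not be checked again after each step. *)
Definition ujoin s t := uniq s -> uniq t -> joinable ustep s t.

Lemma ujoin_refl s : ujoin s s.
Proof. by move=> _ _; exists s; apply: rt_refl. Qed.

Lemma ujoin_stepl s s' t : step s s' -> ujoin s' t -> ujoin s t.
Proof.
move=> st j us ut; have [u s'u tu] := j (step_uniq st us) ut.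
by exists u => //; apply: rt_trans s'u; apply: rt_step.
Qed.

Lemma ujoin_stepr s t t' : step t t' -> ujoin s t' -> ujoin s t.
Proof.
move=> st j us ut; have [u su t'u] := j us (step_uniq st ut).
by exists u => //; apply: rt_trans t'u; apply: rt_step.
Qed.

(* Proves x < z from a chain of strict inequalities in the context; the context
   must be consistent, since the search follows cycles forever. *)
Ltac lt_chain :=
  match goal with
  | H : is_true (?x < ?y) |- is_true (?x < ?z) =>
      first [exact H | apply: (ltn_trans H); lt_chain]
  end.

Ltac one_step :=
  first [ apply: step123; [lt_chain | lt_chain]
        | apply: step213; [lt_chain | lt_chain]
        | eassumption | apply: step_cons; one_step ].

(* Reduces both words greedily, then checks that they agree. *)
Ltac join :=
  repeat (eapply ujoin_stepl; [one_step | ]);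
  repeat (eapply ujoin_stepr; [one_step | ]);
  exact: ujoin_refl.

(** A step at the head of a word against a step that starts one or two letters
    later (the critical pairs) or beyond (disjoint steps). *)
Lemma head_ujoin (p q r : nat) w t1 t2 : uniq [:: p, q, r & w] ->
  (p < q < r /\ t1 = [:: p, r, q & w]) \/
  (q < p < r /\ t1 = [:: r, q, p & w]) ->
  step [:: q, r & w] t2 -> ujoin t1 (p :: t2).
Proof.
move=> us H st.
inversion st as [a b c d lab lbc|a b c d lab lbc|x s t st']; subst; clear st.
- by case: H => -[/andP[H1 H2] ->]; try (exfalso; lia); join.
- by case: H => -[/andP[H1 H2] ->]; try (exfalso; lia); join.
inversion st' as [a b c d lab lbc|a b c d lab lbc|y s' t' st'']; subst;
  clear st'; last by case: H => -[/andP[H1 H2] ->]; join.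
(* The factors p q r and r b c share one letter: the order of b relative to
   p and q matters. *)
all: have [pb qb] : p <> b /\ q <> b by move: us; rewrite /= !inE; lia.
all: clear us; have [H3|H3] : p < b \/ b < p by lia.
all: have [H4|H4] : q < b \/ b < q by lia.
all: by case: H => -[/andP[H1 H2] ->]; try (exfalso; lia); join.
Qed.

Lemma head_confluence (p q r : nat) w t1 t2 : uniq [:: p, q, r & w] ->
  (p < q < r /\ t1 = [:: p, r, q & w]) \/
  (q < p < r /\ t1 = [:: r, q, p & w]) ->
  step [:: q, r & w] t2 -> joinable ustep t1 (p :: t2).
Proof.
move=> us H st; apply: head_ujoin (us) (H) (st) _ _.
  apply: step_uniq us.
  by case: H => -[/andP[H1 H2] ->]; [apply: step123 | apply: step213].
by apply: step_uniq us; apply: step_cons.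
Qed.

Lemma joinable_cons x s t : x \notin s -> x \notin t ->
  joinable ustep s t -> joinable ustep (x :: s) (x :: t).
Proof.
have star u v : x \notin u -> reduces u v -> reduces (x :: u) (x :: v).
  move=> + /clos_rt_rt1n_iff uv; elim: uv => [y|y z v' [uy yz] _ IH] xy.
    exact: rt_refl.
  apply: rt_trans (IH _); first by apply: rt_step; split;
     [rewrite /= xy | apply: step_cons].
  by rewrite -(perm_mem (step_perm yz)).
by move=> xs xt [u su tu]; exists (x :: u); apply: star.
Qed.

Lemma local_confluence s t1 t2 :
  ustep s t1 -> ustep s t2 -> joinable ustep t1 t2.
Proof.
move=> [us st1] [_ st2]; elim: st1 us t2 st2 => {s t1}
  [p q r w pq qr|p q r w qp pr|x s t1 st1 IH] us t2 st2.
- inversion st2 as [p' q' r' w' pq' qr'|p' q' r' w' qp' pr'|y s' t st2']; subst.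
  + by exists [:: p, r, q & w]; apply: rt_refl.
  + by exfalso; lia.
  + by apply: head_confluence us _ st2'; left; rewrite pq qr.
- inversion st2 as [p' q' r' w' pq' qr'|p' q' r' w' qp' pr'|y s' t st2']; subst.
  + by exfalso; lia.
  + by exists [:: r, q, p & w]; apply: rt_refl.
  + by apply: head_confluence us _ st2'; right; rewrite qp pr.
- have /andP[xs us'] := us.
  inversion st2 as [p q r w pq qr|p q r w qp pr|y s' t st2']; subst.
  + apply: joinable_sym; apply: head_confluence us _ st1.
    by left; rewrite pq qr.
  + apply: joinable_sym; apply: head_confluence us _ st1.
    by right; rewrite qp pr.
  + apply: joinable_cons; last exact: IH.
      by rewrite -(perm_mem (step_perm st1)).
    by rewrite -(perm_mem (step_perm st2')).
Qed.

(** * Normal words *)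

(** No letter is larger than both of the two letters just before it. *)
Fixpoint normal (s : seq nat) : bool :=
  if s is p :: s' then
    (if s' is q :: r :: _ then ~~ ((p < r) && (q < r)) else true) && normal s'
  else true.

Lemma normal_cons3 p q r w : normal [:: p, q, r & w] =
  ~~ ((p < r) && (q < r)) && normal [:: q, r & w].
Proof. by []. Qed.

Lemma normal_step s t : normal s -> ~ step s t.
Proof.
move=> ns st; elim: st ns => {s t} [p q r w|p q r w|x s t _ IH] /=.
1,2: by lia.
by case/andP.
Qed.

Lemma step_of_not_normal s : uniq s -> ~~ normal s -> exists t, step s t.
Proof.
elim: s => [//|p [|q [|r w]] IH] us //.
rewrite normal_cons3 negb_and negbK.
case: (boolP (normal [:: q, r & w])) => [_|nn _]; last first.
  have [|t st] := IH _ nn; first by case/andP: us.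
  by exists (p :: t); apply: step_cons.
rewrite orbF => /andP[pr qr].
have pq : p <> q by move: us; rewrite /= !inE; lia.
have [lt|lt] : p < q \/ q < p by lia.
  by exists [:: p, r, q & w]; apply: step123.
by exists [:: r, q, p & w]; apply: step213.
Qed.

Lemma joinable_normal s t :
  normal s -> normal t -> joinable ustep s t -> s = t.
Proof.
have red u v : normal u -> reduces u v -> u = v.
  move=> nu /clos_rt_rt1n_iff; case=> // y z [_ st].
  by case: (normal_step nu st).
by move=> ns nt [u /(red _ _ ns) -> /(red _ _ nt)].
Qed.

(** * Counting normal words *)

Lemma not_normal_late_max m x y t : m \in t -> x < m -> y < m ->
  all (fun z => z <= m) t -> ~~ normal [:: x, y & t].
Proof.
elim: t x y => [//|z t IH] x y; rewrite inE => mt xm ym /andP[zm tm].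
rewrite normal_cons3; case: (eqVneq m z) mt => [<- _|mz /= mt].
  by rewrite xm ym.
by rewrite negb_and (IH y z) ?orbT //; lia.
Qed.

Lemma normal_max m t : all (fun z => z <= m) t -> normal (m :: t) = normal t.
Proof. case: t => [|x [|y t]] //= /and3P[_ ym _]; rewrite ltnNge ym //. Qed.

Lemma normal_max2 m x t : all (fun z => z <= m) t ->
  normal [:: x, m & t] = normal t.
Proof.
move=> tm; rewrite -(normal_max tm).
by case: t tm => [|y t] //= /andP[ym _]; rewrite (ltnNge m y) ym andbF.
Qed.

(** The number of normal rearrangements of s. *)
Definition num_normal s := count normal (permutations s).

Lemma count_permutations_cons (P : pred (seq nat)) s : uniq s -> 0 < size s ->
  count P (permutations s) =
  \sum_(x <- s) count (fun t => P (x :: t)) (permutations (rem x s)).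
Proof.
move=> us s0; have /seq.permP -> := permutationsE s0.
rewrite undup_id // count_flatten sumnE !big_map.
by apply: eq_bigr => x _; rewrite count_map.
Qed.

(** The number of involutions of a set of n elements, by its recurrence. *)
Fixpoint involutions n :=
  match n with
  | 0 => 1
  | n'.+1 => if n' is n''.+1 then involutions n' + n' * involutions n'' else 1
  end.

(** Splitting normal words according to whether the largest letter m comes
    first, or second after a letter x. *)
Lemma num_normal_max s : uniq s -> 1 < size s -> exists2 m, m \in s &
  num_normal s = num_normal (rem m s) +
    \sum_(x <- rem m s) num_normal (rem m (rem x s)).
Proof.
move=> us s1.
have [m ms maxm] : exists2 m, m \in s & {in s, forall z, z <= m}.
  exists (foldr maxn 0 s); last first.
    move=> z; elim: (s) => //= y t IH; rewrite inE leq_max.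
    by case/predU1P=> [->|/IH ->]; rewrite ?leqnn ?orbT.
  case: (s) s1 => [//|x t _]; elim: t x => [|y t IH] x.
    by rewrite /= maxn0 inE.
  rewrite [foldr _ _ _]/= inE /maxn.
  by case: ifP => _; rewrite ?eqxx // IH orbT.
have perm_le t u : perm_eq t u -> {subset u <= s} -> all (fun z => z <= m) t.
  by move=> tu us'; apply/allP => z; rewrite (perm_mem tu) => /us'; apply: maxm.
exists m => //.
rewrite /num_normal (count_permutations_cons _ us (ltnW s1)).
rewrite (big_rem m) //=; congr (_ + _).
  apply: eq_in_count => t; rewrite mem_permutations => pt.
  by apply: normal_max; apply: perm_le pt _; apply: mem_rem.
apply: eq_big_seq => x; rewrite mem_rem_uniq // inE => /andP[xm xs].
have urem : uniq (rem x s) by apply: rem_uniq.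
have mrem : m \in rem x s by rewrite mem_rem_uniq // inE eq_sym xm.
have subrem : {subset rem x s <= s} by apply: mem_rem.
rewrite count_permutations_cons ?size_rem -?subn1 ?subn_gt0 //.
rewrite (big_rem m) //= big1_seq ?addn0.
  apply: eq_in_count => t; rewrite mem_permutations => pt.
  by apply: normal_max2; apply: perm_le pt _ => z /mem_rem/subrem.
(* If x and y both differ from m then m occurs later, and the word is not
   normal. *)
move=> y /=; rewrite mem_rem_uniq // inE => /andP[ym yx].
apply/eqP; rewrite -leqn0 leqNgt -has_count; apply/hasPn => t.
rewrite mem_permutations => pt; apply: (@not_normal_late_max m).
- by rewrite (perm_mem pt) mem_rem_uniq // inE eq_sym ym.
- by rewrite ltn_neqAle xm maxm.
- by rewrite ltn_neqAle ym maxm // subrem.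
- by apply: perm_le pt _ => z /mem_rem/subrem.
Qed.

Lemma num_normalE s : uniq s -> num_normal s = involutions (size s).
Proof.
have [k] := ubnP (size s); elim: k s => // k IH s lt_sk us.
case: (ltnP 1 (size s)) => [s1|]; last first.
  by case: s {us lt_sk} => [|x [|y s]].
have [m ms ->] := num_normal_max us s1.
have szm : size (rem m s) = (size s).-1 by rewrite size_rem.
rewrite IH ?rem_uniq //; last by rewrite szm; lia.
rewrite (eq_big_seq (fun=> involutions (size s).-2)).
  rewrite big_const_seq count_predT iter_addn_0 szm.
  by case: (size s) s1 => [|[|n]] //= _; rewrite mulnC.
move=> x; rewrite mem_rem_uniq // inE => /andP[xm xs].
have mrem : m \in rem x s by rewrite mem_rem_uniq // inE eq_sym xm.
rewrite IH ?rem_uniq // ?size_rem //; lia.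
Qed.

(** * Permutations and their words *)

Lemma word_perm_iota n (s : 'S_n) : perm_eq (word s) (iota 1 n).
Proof.
have /and3P[_ us _] := word_is_order_perm s.
apply: uniq_perm => //; first exact: iota_uniq.
have sub : {subset word s <= iota 1 n}.
  by move=> x /mapP[i _ ->]; rewrite mem_iota /= add1n ltnS ltn_ord.
by have [] := uniq_min_size us sub; rewrite ?size_iota ?size_word.
Qed.

Lemma word_surj n (w : seq nat) : perm_eq w (iota 1 n) ->
  exists s : 'S_n, word s = w.
Proof.
move=> pw; have sw : size w = n by rewrite (perm_size pw) size_iota.
have uw : uniq w by rewrite (perm_uniq pw) iota_uniq.
have wP (i : 'I_n) : 0 < nth 0 w i <= n.
  have : nth 0 w i \in iota 1 n by rewrite -(perm_mem pw) mem_nth ?sw.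
  by rewrite mem_iota add1n ltnS.
have lt (i : 'I_n) : (nth 0 w i).-1 < n by have := wP i; lia.
have inj : injective (fun i => Ordinal (lt i)).
  move=> i j [eq_ij]; apply: val_inj => /=; apply/eqP.
  rewrite -(nth_uniq 0 _ _ uw) ?sw //.
  case/andP: (wP i) (wP j) => [wi _] /andP[wj _].
  by rewrite -(prednK wi) -(prednK wj) eq_ij.
exists (perm inj); apply: (@eq_from_nth _ 0); rewrite size_word // => i lt_i.
by rewrite (nth_word _ (Ordinal lt_i)) permE /= prednK //;
  case/andP: (wP (Ordinal lt_i)).
Qed.

Lemma card_normal n :
  #|[set s : 'S_n | normal (word s)]| = involutions n.
Proof.
rewrite -[n in RHS](size_iota 1 n) -num_normalE ?iota_uniq //.
rewrite /num_normal -size_filter.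
rewrite cardE -(size_map (@word n)); apply/perm_size/uniq_perm.
- by rewrite map_inj_uniq ?enum_uniq //; apply: word_inj.
- by rewrite filter_uniq // permutations_uniq.
move=> w; rewrite mem_filter mem_permutations; apply/mapP/andP.
  by case=> s; rewrite mem_enum inE => ns ->; rewrite word_perm_iota.
case=> nw /word_surj[s ws]; exists s => //.
by rewrite mem_enum inE ws.
Qed.

(** * From K-equivalence to rewriting *)

(** The replacement partition {123, 132} {213, 312} of S_3. *)
Definition Kpart : {set {set 'S_3}} :=
  replacement_partition 3 [:: [:: [:: 1; 2; 3]; [:: 1; 3; 2]];
                              [:: [:: 2; 1; 3]; [:: 3; 1; 2]]].

Lemma order_perm_cmp c u (s : 'S_c) : is_order_perm u s ->
  forall i j, i < c -> j < c ->
  (nth 0 u i < nth 0 u j) = (nth 0 (word s) i < nth 0 (word s) j).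
Proof.
move=> /and3P[_ _ /forallP cmp] i j ic jc.
rewrite (nth_word s (Ordinal ic)) (nth_word s (Ordinal jc)) ltnS.
by have /forallP/(_ (Ordinal jc))/eqP -> := cmp (Ordinal ic).
Qed.

Lemma order_perm3 x y z p q r (s : 'S_3) :
  word s = [:: x; y; z] -> uniq [:: p; q; r] ->
  (x < y) = (p < q) -> (x < z) = (p < r) -> (y < z) = (q < r) ->
  is_order_perm [:: p; q; r] s.
Proof.
move=> ws upqr xy xz yz; apply/and3P; split=> //.
have := word_is_order_perm s; rewrite ws => /and3P[_ uxyz _].
apply/forallP => i; apply/forallP => j; apply/eqP.
rewrite -[LHS]ltnS -!nth_word ws.
move: upqr uxyz; rewrite /= !inE !andbT !negb_or.
case: i j => [[|[|[|i]]] // li] [[|[|[|j]]] // lj] /=; lia.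
Qed.

(** A replacement of u by v with the same letters is trivial or is a step, in
    one direction or the other. *)
Lemma same_part_step u v :
  perm_eq u v -> same_part Kpart u v -> [\/ u = v, step u v | step v u].
Proof.
move=> puv /exists_inP[P PK] /exists_inP[s sP] /exists_inP[t tP] /andP[us vt].
have /and3P[/eqP su uu _] := us; have /and3P[/eqP sv uv _] := vt.
have cu := order_perm_cmp us; have cv := order_perm_cmp vt.
case: u su uu puv cu {us} => [|p [|q [|r [|? ?]]]] // _ uu puv cu.
case: v sv uv puv cv {vt} => [|p' [|q' [|r' [|? ?]]]] // _ uv puv cv.
have := cu 0 1 isT isT; have := cu 0 2 isT isT; have := cu 1 2 isT isT.
have := cv 0 1 isT isT; have := cv 0 2 isT isT; have := cv 1 2 isT isT.
rewrite /= {cu cv} => cv12 cv02 cv01 cu12 cu02 cu01.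
(* [cuij] and [cvij] say that letters i and j of u, resp. v, compare as those of
   the order permutation of u, resp. v. *)
have mem x : x \in [:: p'; q'; r'] -> x \in [:: p; q; r].
  by rewrite (perm_mem puv).
have mp := mem p'; have mq := mem q'; have mr := mem r'.
move: {mem puv} mp mq mr uu uv; rewrite /= !inE !eqxx !orbT !andbT !negb_or.
move=> /(_ isT) mp /(_ isT) mq /(_ isT) mr.
move=> /andP[/andP[pq pr] qr] /andP[/andP[pq' pr'] qr'].
have same : (p < q) = (p' < q') -> (p < r) = (p' < r') -> (q < r) = (q' < r') ->
    [:: p; q; r] = [:: p'; q'; r'].
  by move=> *; congr [:: _; _; _]; lia.
move: PK; rewrite inE => /orP[|/imsetP[w _ Pw]]; last first.
  move: sP tP; rewrite Pw !inE => /eqP es /eqP et; subst.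
  by constructor 1; apply: same; rewrite ?cu01 ?cu02 ?cu12 ?cv01 ?cv02 ?cv12.
rewrite !inE => /orP[]/eqP PE; move: sP tP; rewrite PE !inE.
  move=> /orP[]/eqP ws /orP[]/eqP wt;
    rewrite ws wt /= in cv12 cv02 cv01 cu12 cu02 cu01.
  - by constructor 1; apply: same; rewrite ?cu01 ?cu02 ?cu12 ?cv01 ?cv02 ?cv12.
  - have [-> [-> ->]] : p' = p /\ q' = r /\ r' = q by lia.
    by constructor 2; apply: step123; lia.
  - have [-> [-> ->]] : p' = p /\ q' = r /\ r' = q by lia.
    by constructor 3; apply: step123; lia.
  - by constructor 1; apply: same; rewrite ?cu01 ?cu02 ?cu12 ?cv01 ?cv02 ?cv12.
move=> /orP[]/eqP ws /orP[]/eqP wt;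
    rewrite ws wt /= in cv12 cv02 cv01 cu12 cu02 cu01.
- by constructor 1; apply: same; rewrite ?cu01 ?cu02 ?cu12 ?cv01 ?cv02 ?cv12.
- have [-> [-> ->]] : p' = r /\ q' = q /\ r' = p by lia.
  by constructor 2; apply: step213; lia.
- have [-> [-> ->]] : p' = r /\ q' = q /\ r' = p by lia.
  by constructor 3; apply: step213; lia.
- by constructor 1; apply: same; rewrite ?cu01 ?cu02 ?cu12 ?cv01 ?cv02 ?cv12.
Qed.

Lemma step_kstep n (phi psi : 'S_n) :
  step (word phi) (word psi) -> kstep Kpart phi psi.
Proof.
case/stepP=> a [p [q [r [b [Ephi H]]]]]; apply/kstepP.
have surj w : perm_eq w (iota 1 3) -> exists s : 'S_3, word s = w.
  exact: word_surj.
case: H => -[/andP[l1 l2] Epsi].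
  exists a, [:: p; q; r], [:: p; r; q], b; split=> //.
  have [s ws] := surj [:: 1; 2; 3] isT; have [t wt] := surj [:: 1; 3; 2] isT.
  apply/exists_inP; exists [set s | word s \in [:: [:: 1; 2; 3]; [:: 1; 3; 2]]].
    by rewrite !inE eqxx.
  apply/exists_inP; exists s; first by rewrite inE ws.
  apply/exists_inP; exists t; first by rewrite inE wt.
  by rewrite (order_perm3 ws) ?(order_perm3 wt) //= ?inE; lia.
exists a, [:: p; q; r], [:: r; q; p], b; split=> //.
have [s ws] := surj [:: 2; 1; 3] isT; have [t wt] := surj [:: 3; 1; 2] isT.
apply/exists_inP; exists [set s | word s \in [:: [:: 2; 1; 3]; [:: 3; 1; 2]]].
  by rewrite !inE eqxx orbT.
apply/exists_inP; exists s; first by rewrite inE ws.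
apply/exists_inP; exists t; first by rewrite inE wt.
by rewrite (order_perm3 ws) ?(order_perm3 wt) //= ?inE; lia.
Qed.

Lemma ustep_weight s t : ustep s t -> weight t < weight s.
Proof. by case=> _; apply: step_weight. Qed.

Lemma word_uniq n (s : 'S_n) : uniq (word s).
Proof. by case/and3P: (word_is_order_perm s). Qed.

Lemma kstep_joinable n (phi psi : 'S_n) :
  kstep Kpart phi psi -> joinable ustep (word phi) (word psi).
Proof.
case/kstepP=> a [u [v [b [Ephi Epsi _ _ uv]]]].
have puv : perm_eq u v.
  rewrite -(perm_cat2r b) -(perm_cat2l a) -Ephi -Epsi.
  by rewrite (permPl (word_perm_iota phi)) perm_sym word_perm_iota.
have uphi := word_uniq phi; have upsi := word_uniq psi.
have catr x y : step x y -> step (a ++ x ++ b) (a ++ y ++ b).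
  by move=> xy; apply/step_catl/step_catr.
case: (same_part_step puv uv) => [E|st|st].
- by rewrite Epsi -E -Ephi; exists (word phi); apply: rt_refl.
- by apply: joinable_step; split; rewrite // Ephi Epsi; apply: catr.
- by apply/joinable_sym/joinable_step; split; rewrite // Ephi Epsi; apply: catr.
Qed.

Lemma kequiv_joinable n (phi psi : 'S_n) :
  kequiv Kpart phi psi -> joinable ustep (word phi) (word psi).
Proof.
case/connectP=> p; elim: p phi => [|x p IH] phi /=.
  by move=> _ ->; exists (word phi); apply: rt_refl.
case/andP=> st path_p last_p.
exact: (joinable_trans ustep_weight local_confluence (kstep_joinable st)
                       (IH _ path_p last_p)).
Qed.

Lemma exists_normal n (phi : 'S_n) :
  exists2 psi, kequiv Kpart phi psi & normal (word psi).
Proof.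
have [k] := ubnP (weight (word phi)); elim: k phi => // k IH phi lt_k.
have [|nn] := boolP (normal (word phi)).
  by exists phi => //; apply: connect0.
have [w st] := step_of_not_normal (word_uniq phi) nn.
have [|chi Ew] := word_surj (n := n) (w := w).
  by rewrite -(permPl (step_perm st)) word_perm_iota.
rewrite -Ew in st; have [|psi eq_psi npsi] := IH chi.
  by apply: leq_trans (step_weight st) _.
by exists psi => //; apply: connect_trans eq_psi; apply/connect1/step_kstep.
Qed.

(** The permutations whose words are normal form a transversal of the
    K-classes. *)
Lemma num_classesE n : num_classes Kpart n = involutions n.
Proof.
rewrite /num_classes -card_normal.
have eqv := @kequiv_equivalence 3 Kpart n.
have /card_transversal -> // : is_transversal [set s : 'S_n | normal (word s)]
  (equivalence_partition (@kequiv 3 Kpart n) [set: 'S_n]) [set: 'S_n].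
apply/and3P; split; rewrite ?subsetT //.
  by apply: equivalence_partitionP => x y z _ _ _; apply: eqv.
apply/forall_inP => B /imsetP[phi _ ->].
have [psi phi_psi npsi] := exists_normal phi.
apply/cards1P; exists psi; apply/setP => chi; rewrite !inE.
apply/andP/eqP => [[nchi phi_chi]|->//].
apply/word_inj/joinable_normal => //; apply: kequiv_joinable.
by have [_ <-] := eqv phi chi psi; rewrite ?phi_chi.
Qed.

Theorem proposition3p44 (n : nat) (hn : 3 <= n) :
  let K := replacement_partition 3 [:: [:: [:: 1; 2; 3]; [:: 1; 3; 2]];
                                       [:: [:: 2; 1; 3]; [:: 3; 1; 2]]] in
  let f := num_classes K in
  f n = f (n - 1) + (n - 1) * f (n - 2).
Proof.
rewrite -/Kpart /= !num_classesE.
by case: n hn => [|[|n]] // _; rewrite subn1 subn2.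
Qed.
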